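(* Let $[a,b]\subset\mathbb{R}$ be a compact interval, let $n\ge 1$, and let $\mathfrak{D}=\sum_{j=0}^{n}p_j(x)\partial^j$ be a linear differential operator of order $n$ with real polynomial coefficients. Let $p\ge 0$ be an integer. Then $$\sigma(\mathfrak{D},p)\le \max\{\,n(p+2)-1,\ \Lambda(\mathfrak{D})\,\}+\alpha(\mathfrak{D}).$$
   Context: $[a,b]$ is a fixed compact interval, $a<b$. $\partial=d/dx$, and $\mathfrak{D}=p_n(x)\partial^n+\dots+p_1(x)\partial+p_0(x)$ has order $n$, i.e. $p_n\not\equiv0$. Write $p_j(x)=\sum_i a_{i,j}x^i$, with $a_{i,j}=0$ for $i<0$ or $i>\deg p_j$. Let $d_j=\deg p_j$ ($-\infty$ if $p_j\equiv0$), $\alpha_j=d_j-j$, and $\alpha(\mathfrak{D})=\max_{0\le j\le n}\alpha_j$. Class $\mathcal{PD}(\mathfrak{D},p)$: bounded piecewise-continuous functions $f:[a,b]\to\mathbb{R}$ with $a=\xi_0<\xi_1<\dots<\xi_p<\xi_{p+1}=b$ (depending on $f$), where $\xi_1,\dots,\xi_p$ are the interior points of discontinuity of $f$ and are of the first kind (jumps), and such that on each continuity interval $[\xi_j,\xi_{j+1}]$ $f$ (with one-sided limits as endpoint values) is $n$ times continuously differentiable and satisfies $\mathfrak{D}f=0$. Values at the $\xi_j$ themselves are immaterial: $f\equiv0$ means $f$ vanishes off the $\xi_j$. Moments: $m_k(f)=\int_a^b x^kf(x)\,dx$, $k=0,1,2,\dots$. Moment vanishing index: $$\sigma(\mathfrak{D},p)=\sup_{f\in\mathcal{PD}(\mathfrak{D},p),\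 f\not\equiv0}\{k:\ m_0(f)=\dots=m_k(f)=0\}+1,$$ with $\sigma(\mathfrak{D},p)=0$ if there are no such $f$ and $k\ge0$. Falling factorial: $(y)_j=y(y-1)\cdots(y-j+1)$, $(y)_0=1$. With $\alpha=\alpha(\mathfrak{D})$ define the (nonzero) polynomial $$q_\alpha(k)=\sum_{j=0}^{n}(-1)^j a_{\alpha+j,j}\,(k+\alpha+j)_j .$$ $\Lambda(\mathfrak{D})$ is the largest positive integer zero of $q_\alpha$; if there is none, put $\Lambda(\mathfrak{D})=0$. *)

(* Defs.v *)
From HB Require Import structures.
From mathcomp Require Import all_boot all_order all_algebra.
From mathcomp Require Import all_classical all_reals all_analysis.

Set Implicit Arguments.
Unset Strict Implicit.
Unset Printing Implicit Defensive.

Import Order.TTheory GRing.Theory Num.Theory.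
Import numFieldNormedType.Exports.

Local Open Scope classical_set_scope.
Local Open Scope ring_scope.

(* An operator D = \sum_(j <= n) p_j d^j is given by its coefficients
   P : 'I_n.+1 -> {poly R}; it has order n when P ord_max != 0. *)

Definition coefz (R : realType) (q : {poly R}) (i : int) : R :=
  if i is Posz m then q`_m else 0.

(* The maximum ranges over the j with p_j != 0, the others having
   d_j - j = -oo. The base value, that of j = n, is one of the terms when
   p_n != 0 and is irrelevant otherwise. *)
Definition alpha (R : realType) (n : nat) (P : 'I_n.+1 -> {poly R}) : int :=
  let alpha_ (j : 'I_n.+1) := ((size (P j)).-1)%:Z - (j : nat)%:Z in
  \big[Num.max/alpha_ ord_max]_(j < n.+1 | P j != 0) alpha_ j.

Definition falling (T : nzRingType) (y : T) (j : nat) : T :=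
  \prod_(i < j) (y - i%:R).

(* q_alpha as a polynomial in the indeterminate k = 'X. *)
Definition q_alpha (R : realType) (n : nat) (P : 'I_n.+1 -> {poly R}) :
    {poly R} :=
  \sum_(j < n.+1) ((-1) ^+ j * coefz (P j) (alpha P + (j : nat)%:Z)) *:
    falling ('X + (alpha P + (j : nat)%:Z)%:~R) j.

(* Largest positive integer zero of q_alpha, 0 if there is none. (xget 0 A is
   an element of A, or 0 if A is empty; q_alpha is nonzero when P ord_max is,
   so that a largest zero exists as soon as there is one.) *)
Definition Lambda (R : realType) (n : nat) (P : 'I_n.+1 -> {poly R}) : nat :=
  xget 0%N [set m : nat | [/\ (0 < m)%N, root (q_alpha P) m%:R &
    forall m' : nat, root (q_alpha P) m'%:R -> (m' <= m)%N]].

(* g' is the derivative of g on [c, d], one-sided at c and d. *)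
Definition derivative_on (R : realType) (c d : R) (g g' : R -> R) : Prop :=
  forall x, x \in `[c, d] ->
    (g y - g x) / (y - x) @[y --> within `[c, d] x^'] --> g' x.

(* g 0 is of class C^n on [c, d] and g i is its i-th derivative, i <= n. *)
Definition Cn_jet (R : realType) (c d : R) (n : nat) (g : nat -> R -> R) :
    Prop :=
  (forall i, (i <= n)%N -> {within `[c, d], continuous (g i)}) /\
  (forall i, (i < n)%N -> derivative_on c d (g i) (g i.+1)).

(* f, continued to c and d by its one-sided limits (this continuation is g 0,
   which is continuous on [c, d]), is a C^n solution of D f = 0 on [c, d]. *)
Definition solution_on (R : realType) (n : nat) (P : 'I_n.+1 -> {poly R})
    (c d : R) (f : R -> R) : Prop :=
  exists g : nat -> R -> R,
    [/\ forall x, x \in `]c, d[ -> g 0%N x = f x,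
        Cn_jet c d n g &
        forall x, x \in `[c, d] -> \sum_(j < n.+1) (P j).[x] * g j x = 0].

(* The value f x is irrelevant. *)
Definition jump (R : realType) (f : R -> R) (x : R) : Prop :=
  exists l r : R,
    [/\ f y @[y --> x^'-] --> l, f y @[y --> x^'+] --> r & l != r].

(* f belongs to PD(D, p) with break points xi_0 = a < ... < xi_(p+1) = b; the
   values of xi beyond p + 1, and those of f outside [a, b], are not used. *)
Definition PD (R : realType) (a b : R) (n : nat) (P : 'I_n.+1 -> {poly R})
    (p : nat) (xi : nat -> R) (f : R -> R) : Prop :=
  [/\ [bounded f x | x in `[a, b]],
      xi 0%N = a /\ xi p.+1 = b,
      forall j, (j <= p)%N -> xi j < xi j.+1,
      forall j, (0 < j <= p)%N -> jump f (xi j) &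
      forall j, (j <= p)%N -> solution_on P (xi j) (xi j.+1) f].

Definition nonzero_off (R : realType) (a b : R) (p : nat) (xi : nat -> R)
    (f : R -> R) : Prop :=
  exists x, [/\ x \in `[a, b], forall j, (j <= p.+1)%N -> x != xi j &
    f x != 0].

Definition moment (R : realType) (a b : R) (f : R -> R) (k : nat) : R :=
  \int[@lebesgue_measure R]_(x in `[a, b]) (x ^+ k * f x).

Definition vanishing_orders (R : realType) (a b : R) (n : nat)
    (P : 'I_n.+1 -> {poly R}) (p : nat) : set nat :=
  [set k | exists xi f, [/\ PD a b P p xi f, nonzero_off a b p xi f &
    forall i, (i <= k)%N -> moment a b f i = 0]].

(* The supremum is taken in the extended reals, as it could be infinite. *)
Definition sigma (R : realType) (a b : R) (n : nat) (P : 'I_n.+1 -> {poly R})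
    (p : nat) : \bar R :=
  if `[< vanishing_orders a b P p !=set0 >]
  then (ereal_sup [set (k%:R)%:E | k in vanishing_orders a b P p] + 1)%E
  else 0%E.

(* Main.v *)
Require Import Defs.
From HB Require Import structures.
From mathcomp Require Import all_boot all_order all_algebra.
From mathcomp Require Import all_classical all_reals all_analysis.
From mathcomp Require Import measurable_realfun zify ring lra.
From mathcomp Require Import polyrcf.
Import Order.TTheory GRing.Theory Num.Theory.
Import numFieldNormedType.Exports.
Local Open Scope classical_set_scope.
Local Open Scope ring_scope.

Set Implicit Arguments.
Unset Strict Implicit.
Unset Printing Implicit Defensive.

(* Let L q be the integral of q f over [a, b], let D* be the formal adjoint
   of D, and let M = max(n(p+2) - 1, Lambda). Integrating q (D f) = 0 by parts
   on each piece gives L(D* q) = 0 as soon as q vanishes to order n at the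
   p + 2 points xi_j, i.e. when q is a multiple of
   Om = \prod_j (X - xi_j)^n, which kills the boundary terms. If the moments
   vanish up to order M + alpha, then L(D* X^m) = 0 for m <= M too, since
   D* X^m has degree at most m + alpha; as deg Om = n(p+2) <= M + 1, Euclidean
   division by Om yields L(D* q) = 0 for every q. The coefficient of
   X^(m + alpha) in D* X^m is q_alpha(m), which is nonzero for m > M, so all
   moments vanish by induction, and f = 0 at its continuity points. *)

(** * Polynomials: multiplicities of roots, bounds on roots, falling factorials *)

Lemma dvdp_exp_deriv (F : fieldType) (x : F) (i : nat) (q : {poly F}) :
  ('X - x%:P) ^+ i.+1 %| q -> ('X - x%:P) ^+ i %| q^`().
Proof.
move=> /dvdpP[s ->]; rewrite derivM deriv_exp derivXsubC mul1r /=.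
rewrite -mulr_natr mulrA dvdp_addr.
  by rewrite dvdp_mulr // dvdp_mull.
by rewrite exprS !dvdp_mull.
Qed.

Lemma nat_roots_bounded (R : archiRcfType) (q : {poly R}) : q != 0 ->
  exists B : nat, forall m : nat, root q m%:R -> (m <= B)%N.
Proof.
move=> q0; exists (Num.bound (cauchy_bound q)) => m /rootP/(cauchy_boundP q0).
rewrite normr_nat => /lt_trans/(_ (archi_boundP (cauchy_bound_ge0 q))).
by rewrite ltr_nat => /ltnW.
Qed.

Lemma falling_natr (R : nzRingType) (m j : nat) :
  falling (m%:R : R) j = (m ^_ j)%:R.
Proof.
elim: j => [|j IH]; rewrite /falling ?big_ord0 ?ffactn0 // big_ord_recr /=.
rewrite -/(falling _ _) IH ffactnSr natrM.
have [jm|mj] := leqP j m; first by rewrite natrB.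
by rewrite (ffact_small mj) !mul0r.
Qed.

Lemma horner_falling (R : comNzRingType) (c x : R) (j : nat) :
  (falling ('X + c%:P) j).[x] = falling (x + c) j.
Proof.
by rewrite horner_prod; apply: eq_bigr => i _;
  rewrite -polyC_natr hornerD hornerN hornerD hornerX !hornerC.
Qed.

(** Once the factors have the form ['X - c%:P], the library facts on products of linear factors show
    that this falling factorial is monic of degree [j]. *)
Lemma falling_XaddC (R : comNzRingType) (c : R) (j : nat) :
  falling ('X + c%:P) j = \prod_(i <- enum 'I_j) ('X - (i%:R - c)%:P).
Proof.
rewrite big_enum; apply: eq_bigr => i _.
by rewrite polyCB opprB polyC_natr addrA.
Qed.

(** * The operator: [alpha], [q_alpha], the formal adjoint, and functionals vanishing on its
    image *)

Section operator.
Context (R : realType) (n : nat) (P : 'I_n.+1 -> {poly R}).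
Hypothesis Pn0 : P ord_max != 0.

Lemma le_alpha (j : 'I_n.+1) : P j != 0 ->
  (size (P j)).-1%:Z - (j : nat)%:Z <= alpha P.
Proof.
exact: (le_bigmax_cond _
  (fun j : 'I__ => (size (P j)).-1%:Z - (j : nat)%:Z)).
Qed.

Lemma alpha_attained : exists2 j, P j != 0 &
  alpha P = (size (P j)).-1%:Z - (j : nat)%:Z.
Proof.
rewrite /alpha; elim/big_ind: _ => [|x y [i Pi ->] [j Pj ->]|j Pj].
- by exists ord_max.
- by rewrite maxEle; case: ifP; [exists j|exists i].
- by exists j.
Qed.

Lemma alpha_ge : - n%:Z <= alpha P.
Proof. by have := le_alpha Pn0; rewrite /=; lia. Qed.

Lemma coefz_gt_alpha (j : 'I_n.+1) (i : int) : alpha P + (j : nat)%:Z < i ->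
  coefz (P j) i = 0.
Proof.
case: i => [i|//]; have [->|Pj] := eqVneq (P j) 0; first by rewrite /= coef0.
move=> lti; apply: nth_default; have := le_alpha Pj.
by set s := size _; rewrite -/s; lia.
Qed.

(** The maximum defining [alpha P] is attained at some [j], and there the coefficient is the leading
    coefficient of [P j], so not all coefficients vanish. The falling factorials have pairwise
    distinct degrees [j], so the term with the largest [j] among the nonzero ones cannot be
    cancelled. *)
Lemma q_alpha_neq0 : q_alpha P != 0.
Proof.
pose c (j : 'I_n.+1) := coefz (P j) (alpha P + (j : nat)%:Z).
have [j0 cj0] : exists j, c j != 0.
  have [j Pj aj] := alpha_attained; exists j.
  by rewrite /c aj subrK /= -lead_coefE lead_coef_eq0.
case: (@arg_maxnP _ j0 (fun j => c j != 0) (fun j => j : nat) cj0) => j cj jmax.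
apply/negP => /eqP /(congr1 (fun q : {poly R} => q`_j)).
rewrite coef0 coef_sum (bigD1 j) //= big1 ?addr0 => [|i ij].
  rewrite coefZ -[_%:~R](rmorph_int polyC) falling_XaddC.
  have /monicP := monic_prod_XsubC (enum 'I_j) xpredT
     (fun i : 'I_j => i%:R - (alpha P + j%:Z)%:~R : R).
  rewrite lead_coefE size_prod_XsubC size_enum_ord => ->.
  by move/eqP; rewrite mulr1 mulf_eq0 signr_eq0 (negPf cj).
rewrite coefZ -/(c i); have [->|ci] := eqVneq (c i) 0.
  by rewrite mulr0 mul0r.
rewrite nth_default ?mulr0 // -[_%:~R](rmorph_int polyC) falling_XaddC.
rewrite size_prod_XsubC size_enum_ord ltn_neqAle (jmax i ci : (i <= j)%N) andbT.
by rewrite (inj_eq val_inj).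
Qed.

Lemma le_Lambda (m : nat) : (0 < m)%N -> root (q_alpha P) m%:R ->
  (m <= Lambda P)%N.
Proof.
move=> m0 rm; have [B leB] := nat_roots_bounded q_alpha_neq0.
have [//|M rM maxM] := @ex_maxnP (fun m => root (q_alpha P) m%:R) B _ leB.
  by exists m.
(* The largest root [M] satisfies [M >= m > 0], so the set is nonempty and [xget] does not return
   its default 0. *)
have [|_ _ maxL] := @xgetPex _ 0%N [set m : nat | [/\ (0 < m)%N,
    root (q_alpha P) m%:R & forall m' : nat, root (q_alpha P) m'%:R ->
    (m' <= m)%N]]%classic; last exact: maxL.
exists M; split => //; exact: leq_trans (maxM _ rm).
Qed.

Definition adjoint (q : {poly R}) : {poly R} :=
  \sum_(j < n.+1) (-1) ^+ j *: (P j * q)^`(j).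

Lemma adjoint_linear : linear adjoint.
Proof.
move=> c q r; rewrite /adjoint scaler_sumr -big_split /=; apply: eq_bigr => j _.
by rewrite mulrDr -scalerAr derivnD derivnZ scalerDr !scalerA mulrC.
Qed.

HB.instance Definition _ :=
  GRing.isLinear.Build R {poly R} {poly R} *:%R adjoint adjoint_linear.

Lemma coef_adjointXn (m k : nat) : (adjoint 'X^m)`_k =
  \sum_(j < n.+1)
    (-1) ^+ j * coefz (P j) ((j + k)%N%:Z - m%:Z) * ((j + k) ^_ j)%:R.
Proof.
rewrite coef_sum; apply: eq_bigr => j _.
rewrite coefZ coef_derivn coefMXn -[in LHS]mulr_natr mulrA; congr (_ * _ * _).
(* For [j + k < m] the integer index is negative, where [coefz] is 0 by definition; this matches the
   zero low coefficients of a multiple of ['X^m]. *)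
have [jkm|mjk] := ltnP; last by rewrite subzn.
by rewrite -opprB subzn 1?ltnW // -(prednK (n := m - (j + k))) // subn_gt0.
Qed.

Lemma coef_adjointXn_lead (m k : nat) : k%:Z = m%:Z + alpha P ->
  (adjoint 'X^m)`_k = (q_alpha P).[m%:R].
Proof.
move=> kE; rewrite coef_adjointXn /q_alpha horner_sum; apply: eq_bigr => j _.
rewrite hornerZ -[_%:~R](rmorph_int polyC) horner_falling.
have -> : (j + k)%N%:Z - m%:Z = alpha P + j%:Z by lia.
rewrite -[m%:R]/(m%:Z%:~R) -intrD.
have -> : m%:Z + (alpha P + j%:Z) = (j + k)%N by lia.
by rewrite falling_natr.
Qed.

Lemma coef_adjointXn_gt (m k : nat) : m%:Z + alpha P < k%:Z ->
  (adjoint 'X^m)`_k = 0.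
Proof.
move=> ltk; rewrite coef_adjointXn big1 // => j _.
by rewrite coefz_gt_alpha ?mulr0 ?mul0r //; lia.
Qed.

(** The algebraic core, for an arbitrary linear functional. The condition on [size Om] says that
    [Om] is nonzero of degree at most [M + 1], so that remainders modulo [Om] have degree at most
    [M]. *)
Lemma functional_eq0 (L : {scalar {poly R}}) (Om : {poly R}) (M k : nat) :
  (forall q, L (adjoint (q * Om)) = 0) -> ((0 < size Om <= M.+2)%N) ->
  (Lambda P <= M)%N -> M%:Z + alpha P <= k%:Z ->
  (forall i, (i <= k)%N -> L 'X^i = 0) -> forall q, L q = 0.
Proof.
move=> LOm /andP[Om0 OmM] LM Mk Lk.
have Lsum q : L q = \sum_(i < size q) q`_i * L 'X^i.
  rewrite -[q in LHS]coefK poly_def linear_sum; apply: eq_bigr => i _.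
  by rewrite linearZ.
have LadjX m : (m <= M)%N -> L (adjoint 'X^m) = 0.
  move=> mM; rewrite Lsum big1 // => l _.
  have [lk|kl] := leqP l k; first by rewrite Lk ?mulr0.
  by rewrite coef_adjointXn_gt ?mul0r //; lia.
have Ladj q : L (adjoint q) = 0.
  rewrite (divp_eq q Om) !linearD LOm add0r -[_ %% _]coefK poly_def.
  rewrite (linear_sum adjoint) (linear_sum L).
  rewrite big1 //= => i _.
  rewrite (linearZ_LR adjoint) (linearZ_LR L) /= LadjX ?mulr0 //.
  rewrite -ltnS; apply: leq_trans (ltn_ord i) _; rewrite -ltnS.
  by apply: leq_trans OmM; rewrite ltn_modp -size_poly_gt0.
have LX i : L 'X^i = 0.
  have [l] := ubnP i; elim: l i => // l IH i il.
  have [ik|ki] := leqP i k; first exact: Lk.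
  (* Since [i > k >= M + alpha P], the integer [i - alpha P] exceeds [M]. It is therefore a positive
     natural number larger than [Lambda P], hence not a root of [q_alpha P]. *)
  have [m mE] : exists m : nat, m%:Z = i%:Z - alpha P.
    by exists `|i%:Z - alpha P|%N; rewrite gez0_abs //; lia.
  have qm : (q_alpha P).[m%:R] != 0.
    by apply/negP => /(@le_Lambda m); lia.
  have := Ladj 'X^m; rewrite Lsum.
  have isz : (i < size (adjoint 'X^m))%N.
    rewrite ltnNge; apply/negP => /leq_sizeP/(_ i (leqnn _))/eqP.
    by rewrite coef_adjointXn_lead ?(negPf qm) //; lia.
  (* In the expansion of [L (adjoint 'X^m)], the terms below [i] vanish by induction and those above
     [i] have zero coefficient. *)
  rewrite (bigD1 (Ordinal isz)) //= big1 => [|l' ne].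
    rewrite addr0 coef_adjointXn_lead; last by lia.
    by move/eqP; rewrite mulf_eq0 (negPf qm) /= => /eqP.
  have [li|li] := ltnP l' i; first by rewrite IH ?mulr0 //; lia.
  rewrite coef_adjointXn_gt ?mul0r //.
  by have : l' != i :> nat by []; lia.
by move=> q; rewrite Lsum big1 // => i _; rewrite LX mulr0.
Qed.

End operator.

(** * Integration by parts on a single continuity interval *)

Lemma Rintegral_sum d (T : measurableType d) (R : realType)
    (mu : {measure set T -> \bar R}) (D : set T) (I : Type) (s : seq I)
    (f : I -> T -> R) : measurable D ->
  (forall i, mu.-integrable D (EFin \o f i)) ->
  \int[mu]_(x in D) (\sum_(i <- s) f i x) =
  \sum_(i <- s) \int[mu]_(x in D) f i x.
Proof.
move=> mD intf; rewrite /Rintegral; under eq_integral do rewrite -sumEFin.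
rewrite integral_sum // sum_fine // => i _.
exact: (integrable_fin_num mD (intf i)).
Qed.

Section piece.
Context (R : realType).
Implicit Types (c d x : R) (g : nat -> R -> R) (q : {poly R}).
Notation mu := (@lebesgue_measure R).

(** Near an interior point the restriction to [[c, d]] holds automatically; the substitution
    [y = k + x] then turns one difference quotient into the other. *)
Lemma is_derive_derivative_on c d (h h' : R -> R) x :
  derivative_on c d h h' -> x \in `]c, d[ -> is_derive x 1 h (h' x).
Proof.
move=> dh xcd; have xcd' : x \in `[c, d] by exact: subset_itv_oo_cc.
have cdx : \forall y \near x^', y \in `[c, d].
  apply: nbhs_dnbhs; near=> y; apply: subset_itv_oo_cc.
  by near: y; exact: near_in_itvoo.
have shx : (h + x @[h --> (0:R)^']) --> x^'.
  move=> A xA; change (\forall k \near (0 : R), k != 0 -> A (k + x)).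
  have : \forall y \near x, y != x -> A y by [].
  rewrite (near_shift 0 x (fun y => y != x -> A y)) subr0.
  by apply: filterS => k /= Ak k0; apply: Ak; rewrite -subr_eq0 addrK.
have lim : k^-1 *: ((h \o shift x) (k *: 1) - h x) @[k --> (0:R)^'] --> h' x.
  have -> : (fun k : R => k^-1 *: ((h \o shift x) (k *: 1) - h x)) =
      (fun y => (h y - h x) / (y - x)) \o (fun k => k + x).
    by apply/funext => k /=; rewrite addrK [k%:A]mulr1 mulrC.
  apply: cvg_comp shx _; apply: cvg_trans (dh x xcd'); apply: cvg_app => A cdA.
  by apply: filterS2 cdx cdA => y /[swap]; apply.
by apply: DeriveDef; [exact: cvgP lim|exact: cvg_lim lim].
Unshelve. all: by end_near. Qed.

Lemma jet_LRcontinuous c d n g i : c < d -> Cn_jet c d n g -> (i < n)%N ->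
  derivable_oo_LRcontinuous (g i) c d.
Proof.
move=> cd [cg dg] iltn.
have /(continuous_within_itvP _ cd)[_ gc gd] := cg _ (ltnW iltn).
by split=> // x /(is_derive_derivative_on (dg _ iltn))[].
Qed.

Lemma horner_LRcontinuous q c d : derivable_oo_LRcontinuous (horner q) c d.
Proof.
split=> [x _||]; first exact: derivable_horner.
- by apply: cvg_at_right_filter; exact: continuous_horner.
- by apply: cvg_at_left_filter; exact: continuous_horner.
Qed.

Lemma integrable_horner_jet c d n g i q : Cn_jet c d n g -> (i <= n)%N ->
  mu.-integrable `[c, d] (EFin \o (fun x => q.[x] * g i x)).
Proof.
move=> [cg _] iltn; apply: continuous_compact_integrable.
  exact: segment_compact.
move=> x; apply: continuousM; last exact: cg.
by apply: continuous_subspaceT; exact: continuous_horner.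
Qed.

(** Each integration by parts moves one derivative from [g] to [q] at the cost of a sign. It lowers
    the multiplicity of the roots [c] and [d] by one, which still leaves enough to kill the next
    boundary term. *)
Lemma ibp_jet c d n g i q : c < d -> Cn_jet c d n g -> (i <= n)%N ->
  ('X - c%:P) ^+ i %| q -> ('X - d%:P) ^+ i %| q ->
  \int[mu]_(x in `[c, d]) (q.[x] * g i x) =
  (-1) ^+ i * \int[mu]_(x in `[c, d]) (q^`(i).[x] * g 0%N x).
Proof.
move=> cd gn; elim: i q => [|i IH] q iltn qc qd; first by rewrite mul1r.
have q0 x : ('X - x%:P) ^+ i.+1 %| q -> q.[x] = 0.
  move=> qx; apply/rootP; rewrite -dvdp_XsubCl; apply: dvdp_trans qx.
  by rewrite exprS dvdp_mulr.
rewrite (@Rintegration_by_parts _ (horner q) (g i) (horner q^`())) //.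
- rewrite !q0 // !mul0r subrr sub0r IH ?dvdp_exp_deriv // 1?ltnW //.
  by rewrite exprS mulN1r mulNr -derivSn.
- by apply: continuous_subspaceT; exact: continuous_horner.
- exact: horner_LRcontinuous.
- by move=> x _; rewrite -derivE.
- exact: gn.1.
- exact: jet_LRcontinuous gn iltn.
- move=> x /(is_derive_derivative_on (gn.2 _ iltn)) dx.
  by rewrite derive1E derive_val.
Qed.

(** Undoing the integrations by parts term by term turns the integrand into [q] times the left-hand
    side of the differential equation. *)
Lemma adjoint_jet c d n (P : 'I_n.+1 -> {poly R}) g q : c < d ->
  Cn_jet c d n g ->
  (forall x, x \in `[c, d] -> \sum_(j < n.+1) (P j).[x] * g j x = 0) ->
  ('X - c%:P) ^+ n %| q -> ('X - d%:P) ^+ n %| q ->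
  \int[mu]_(x in `[c, d]) ((adjoint P q).[x] * g 0%N x) = 0.
Proof.
move=> cd gn Pg qc qd.
have jn (j : 'I_n.+1) : (j <= n)%N by rewrite -ltnS.
transitivity (\sum_(j < n.+1) \int[mu]_(x in `[c, d]) ((P j * q).[x] * g j x)).
  transitivity (\sum_(j < n.+1) \int[mu]_(x in `[c, d])
      (((-1) ^+ j *: (P j * q)^`(j)).[x] * g 0%N x)).
    rewrite -Rintegral_sum //= => [|j]; last exact: integrable_horner_jet gn _.
    apply: eq_Rintegral => x _.
    by rewrite horner_sum mulr_suml.
  apply: eq_bigr => j _.
  rewrite (ibp_jet cd gn) //; last 2 first.
  - by apply: dvdp_mull; apply: dvdp_trans qc; exact: dvdp_exp2l.
  - by apply: dvdp_mull; apply: dvdp_trans qd; exact: dvdp_exp2l.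
  rewrite -RintegralZl //; last exact: integrable_horner_jet gn _.
  by apply: eq_Rintegral => x _; rewrite hornerZ mulrA.
rewrite -Rintegral_sum //= => [|j]; last exact: integrable_horner_jet gn _.
transitivity (\int[mu]_(x in `[c, d]) (0 : R)); last first.
  by rewrite Rintegral_cst // mul0r.
apply: eq_Rintegral => x; rewrite inE /= => xcd.
transitivity (q.[x] * \sum_(j < n.+1) (P j).[x] * g j x); last first.
  by rewrite Pg ?mulr0.
by rewrite mulr_sumr; apply: eq_bigr => j _; rewrite hornerM mulrAC mulrC.
Qed.

End piece.

(** * Determinacy: a bounded function orthogonal to all polynomials vanishes where it is
    continuous *)

Lemma bernoulli_ineq (R : realDomainType) (x : R) (N : nat) : 0 <= x ->
  1 + N%:R * x <= (1 + x) ^+ N.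
Proof.
move=> x0; elim: N => [|N IH]; first by rewrite expr0 mul0r addr0.
rewrite exprS -natr1; have /(ler_wpM2l (_ : 0 <= 1 + x)) := IH.
rewrite addr_ge0 // => /(_ isT); apply: le_trans.
have : 0 <= N%:R * (x * x) by rewrite !mulr_ge0.
nra.
Qed.

Section determinacy.
Context (R : realType).
Implicit Types (a b c m : R) (f : R -> R) (q : {poly R}).
Notation mu := (@lebesgue_measure R).

Lemma Rintegral_split a b c f : a <= b -> b <= c ->
  mu.-integrable `[a, c] (EFin \o f) ->
  \int[mu]_(x in `[a, c]) f x =
  \int[mu]_(x in `[a, b]) f x + \int[mu]_(x in `[b, c]) f x.
Proof.
move=> ab bc intf.
have -> : \int[mu]_(x in `[b, c]) f x = \int[mu]_(x in `]b, c]) f x.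
  rewrite Rintegral_itv_obnd_cbnd //; apply: integrableS intf => //.
  by apply: subset_itvr; rewrite bnd_simp.
by rewrite -(Rintegral_itvB intf) ?bnd_simp // addrC subrK.
Qed.

Lemma Rintegral_ge_cst a b m f : a <= b ->
  mu.-integrable `[a, b] (EFin \o f) -> (forall x, x \in `[a, b] -> m <= f x) ->
  m * (b - a) <= \int[mu]_(x in `[a, b]) f x.
Proof.
move=> ab intf mf.
have -> : m * (b - a) = \int[mu]_(x in `[a, b]) m.
  rewrite Rintegral_cst //= lebesgue_measure_itv /= lte_fin.
  by case: ltgtP ab => // -> _; rewrite subrr.
apply: le_Rintegral => //.
apply: continuous_compact_integrable; first exact: segment_compact.
by move=> x; exact: cst_continuous.
Qed.

Lemma integrable_horner_bounded a b f q : measurable_fun `[a, b] f ->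
  [bounded f x | x in `[a, b]] ->
  mu.-integrable `[a, b] (EFin \o (fun x => q.[x] * f x)).
Proof.
move=> mf bf.
have -> : EFin \o (fun x => q.[x] * f x) =
    ((EFin \o f) \* (EFin \o horner q))%E.
  by apply/funext => x /=; rewrite mulrC EFinM.
apply: integrableMr => //.
apply: continuous_compact_integrable; first exact: segment_compact.
by apply: continuous_subspaceT; exact: continuous_horner.
Qed.

(** One of the two inequalities, by contradiction; the other comes from [- f]. Continuity is assumed
    at [x0] alone, so jumps of [f] elsewhere are allowed. *)
Lemma moments_eq0_le0 a b f x0 : x0 \in `]a, b[ -> {for x0, continuous f} ->
  measurable_fun `[a, b] f -> [bounded f x | x in `[a, b]] ->
  (forall q, \int[mu]_(x in `[a, b]) (q.[x] * f x) = 0) -> f x0 <= 0.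
Proof.
move=> x0ab cf mf bf f0; rewrite leNgt; apply/negP => fx0.
have [/andP[ax0 x0b]] : a < x0 < b by move: x0ab; rewrite in_itv.
have [B B0 fB] : exists2 B, 0 <= B & forall x, x \in `[a, b] -> `|f x| <= B.
  case: bf => M [_ MB]; exists (`|M| + 1); first by rewrite addr_ge0.
  by apply: MB; rewrite (le_lt_trans (ler_norm M)) // ltrDl.
pose m := f x0 / 2; have m0 : 0 < m by rewrite divr_gt0.
have [e e0 fe] : exists2 e : R, 0 < e & forall x, `|x - x0| <= e ->
    x \in `[a, b] /\ m <= f x.
  have : \forall x \near x0, (x \in `]a, b[) /\ `|f x0 - f x| < m.
    near=> x; split; near: x; first exact: near_in_itvoo.
    by move/cvgrPdist_lt : cf; exact.
  (* Halving the radius makes the estimate hold on a closed ball. *)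
  move=> /nbhs_normP[e /= e0 fe]; exists (e / 2); first by rewrite divr_gt0.
  move=> x xe; have [|xab fx] := fe x.
    by rewrite /= distrC (le_lt_trans xe) // ltr_pdivrMr // ltr_pMr // ltr1n.
  split; first exact: subset_itv_oo_cc.
  by move: fx; rewrite ltr_norml /m => /andP[]; lra.
(* With this scaling [c * (x - x0) ^+ 2 <= 1] on [[a, b]], which makes [q] nonnegative there. *)
pose c := ((b - a) ^+ 2)^-1.
have ba : 0 < b - a by lra.
have c0 : 0 < c by rewrite invr_gt0 exprn_gt0.
(* On [a, b], 0 <= q, with q <= 1 where |x - x0| >= e and q >= 1 + k where
   |x - x0| <= e / 2: for large N the integral of q^N f is dominated by the
   contribution of a neighbourhood of x0. *)
pose q := (1 + c * e ^+ 2)%:P - c *: ('X - x0%:P) ^+ 2.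
have qE x : q.[x] = 1 + c * (e ^+ 2 - (x - x0) ^+ 2).
  by rewrite /q hornerD hornerN hornerZ horner_exp hornerXsubC hornerC; ring.
have q_ge0 x : x \in `[a, b] -> 0 <= q.[x].
  rewrite in_itv /= qE => /andP[ax xb].
  have : c * (x - x0) ^+ 2 <= 1.
    rewrite /c mulrC ler_pdivrMr ?exprn_gt0 // mul1r.
    rewrite -[leLHS]real_normK ?num_real // lerXn2r ?nnegrE ?(ltW ba) //.
    by rewrite ler_norml; apply/andP; split; lra.
  have : 0 <= c * e ^+ 2 by rewrite mulr_ge0 ?sqr_ge0 // ltW.
  nra.
(* For [|x - x0| <= e / 2] one has [e ^+ 2 - (x - x0) ^+ 2 >= 3 / 4 * e ^+ 2], whence
   [q >= 1 + k]. *)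
pose k := c * (e ^+ 2 * (3 / 4)).
have k0 : 0 < k by rewrite !mulr_gt0 // exprn_gt0.
have kme0 : 0 < k * m * e by rewrite !mulr_gt0.
(* By Bernoulli, [q ^+ N >= 1 + N * k] on a window of length [e] where [f >= m]. The gain is at
   least [N * k * m * e], while the loss elsewhere is at most [B * (b - a)]. *)
have [N NB] : exists N : nat, B * (b - a) < N%:R * (k * m * e).
  exists (Num.bound (B * (b - a) / (k * m * e))); rewrite -ltr_pdivrMr //.
  by apply: archi_boundP; rewrite divr_ge0 ?mulr_ge0 // ltW.
pose F x := (q ^+ N).[x] * f x.
have intF : mu.-integrable `[a, b] (EFin \o F).
  exact: integrable_horner_bounded.
(* Within distance [e] of [x0], [F] is nonnegative because [f] is; farther away [q <= 1], so
   [|F| <= B]. *)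
have geB x : x \in `[a, b] -> - B <= F x.
  move=> xab; have [xe|ex] := leP `|x - x0| e.
    rewrite (le_trans (_ : _ <= 0)) ?oppr_le0 // mulr_ge0 //.
      by rewrite horner_exp exprn_ge0 // q_ge0.
    by have [_] := fe _ xe; lra.
  have : `|F x| <= B.
    rewrite normrM -[leRHS]mul1r ler_pM ?fB // horner_exp normrX exprn_ile1 //.
    rewrite ger0_norm ?q_ge0 // qE gerDl pmulr_rle0 // subr_le0.
    by rewrite -[leRHS]real_normK ?num_real // lerXn2r ?nnegrE // ltW.
  by rewrite ler_norml => /andP[].
pose u := x0 - e / 2; pose v := x0 + e / 2.
have geK x : x \in `[u, v] -> (1 + N%:R * k) * m <= F x.
  rewrite in_itv /= => /andP[ux xv].
  have xe : `|x - x0| <= e / 2.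
    by rewrite ler_norml; rewrite /u /v in ux xv; lra.
  have [|xab mfx] := fe x; first by lra.
  rewrite ler_pM // ?(ltW m0) //; first by rewrite addr_ge0 // mulr_ge0 // ltW.
  rewrite horner_exp (le_trans (bernoulli_ineq N (ltW k0))) //.
  rewrite lerXn2r ?nnegrE ?q_ge0 //; first by rewrite addr_ge0 // ltW.
  rewrite qE lerD2l /k ler_pM2l //.
  have : (x - x0) ^+ 2 <= (e / 2) ^+ 2.
    rewrite -[leLHS]real_normK ?num_real // lerXn2r ?nnegrE //.
    by rewrite divr_ge0 // ltW.
  rewrite !expr2; nra.
have [|uab _] := fe u.
  by rewrite /u ler_norml; apply/andP; split; lra.
have [|vab _] := fe v.
  by rewrite /v ler_norml; apply/andP; split; lra.
have uv : u <= v by rewrite /u /v; lra.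
move: uab vab; rewrite !in_itv /= => /andP[au ub] /andP[av vb].
have ivb : mu.-integrable `[u, b] (EFin \o F).
  by apply: integrableS intF => //; apply: subset_itvr; rewrite bnd_simp.
have := f0 (q ^+ N).
rewrite (Rintegral_split au ub intF) (Rintegral_split uv vb ivb).
have : - B * (u - a) <= \int[mu]_(x in `[a, u]) F x.
  apply: Rintegral_ge_cst => // [|x].
    by apply: integrableS intF => //; apply: subset_itvl; rewrite bnd_simp.
  rewrite in_itv /= => /andP[ax xu].
  by rewrite geB // in_itv /= ax (le_trans xu).
have : - B * (b - v) <= \int[mu]_(x in `[v, b]) F x.
  apply: Rintegral_ge_cst => // [|x].
    by apply: integrableS ivb => //; apply: subset_itvr; rewrite bnd_simp.
  rewrite in_itv /= => /andP[vx xb].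
  by rewrite geB // in_itv /= xb (le_trans av).
have : (1 + N%:R * k) * m * (v - u) <= \int[mu]_(x in `[u, v]) F x.
  apply: Rintegral_ge_cst => //.
  by apply: integrableS ivb => //; apply: subset_itvl; rewrite bnd_simp.
rewrite -/F.
set I1 := Rintegral _ _ _; set I2 := Rintegral _ _ _; set I3 := Rintegral _ _ _.
have -> : v - u = e by rewrite /u /v; lra.
have : 0 <= B * e by rewrite mulr_ge0 // ltW.
have : 0 <= m * e by rewrite mulr_ge0 // ltW.
rewrite /u /v; move: NB; nra.
Unshelve. all: by end_near. Qed.

Lemma moments_eq0 a b f x0 : x0 \in `]a, b[ -> {for x0, continuous f} ->
  measurable_fun `[a, b] f -> [bounded f x | x in `[a, b]] ->
  (forall q, \int[mu]_(x in `[a, b]) (q.[x] * f x) = 0) -> f x0 = 0.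
Proof.
move=> x0ab cf mf bf f0; apply/eqP; rewrite eq_le (moments_eq0_le0 x0ab) //=.
rewrite -oppr_le0; apply: (@moments_eq0_le0 a b (\- f)) => //.
- exact: cvgN.
- exact: measurableT_comp.
- case: bf => M [Mr MB]; exists M; split => // y My x /=.
  by rewrite normrN; exact: MB.
- move=> q; rewrite -[RHS](f0 (- q)); apply: eq_Rintegral => x _.
  by rewrite hornerN mulrN mulNr.
Qed.

End determinacy.

(** * Gluing the pieces of a function of the class *)

Section breakpoints.
Context (R : realType) (a b : R) (n : nat) (P : 'I_n.+1 -> {poly R}) (p : nat).
Context (xi : nat -> R) (f : R -> R).
Hypothesis PDf : PD a b P p xi f.
Notation mu := (@lebesgue_measure R).

Let xi0 : xi 0%N = a. Proof. by case: PDf => _ []. Qed.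

Let xip : xi p.+1 = b. Proof. by case: PDf => _ []. Qed.

Let xi_lt j : (j <= p)%N -> xi j < xi j.+1.
Proof. by case: PDf => _ _ + _ _; exact. Qed.

Lemma PD_le j k : (j <= k <= p.+1)%N -> xi j <= xi k.
Proof.
move=> /andP[jk kp]; elim: k jk kp => [|k IH].
  by rewrite leqn0 => /eqP ->.
rewrite leq_eqVlt => /predU1P[->//|jk] kp.
by rewrite (le_trans (IH jk (ltnW kp))) // ltW // xi_lt.
Qed.

Lemma PD_locate x : x \in `[a, b] -> (forall j, (j <= p.+1)%N -> x != xi j) ->
  exists2 j, (j <= p)%N & x \in `]xi j, xi j.+1[.
Proof.
rewrite in_itv /= => /andP[ax xb] xN.
have ltx : exists k, (k <= p.+1)%N && (x < xi k).
  by exists p.+1; rewrite leqnn lt_neqAle xN //= xip.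
(* The right end of the piece containing [x] is the first break point beyond [x]. *)
have [[|k] /andP[kp xk] kmin] := ex_minnP ltx.
  by move: xk; rewrite xi0 ltNge ax.
exists k => //; rewrite in_itv /= xk andbT lt_neqAle eq_sym xN ?(ltnW kp) //=.
rewrite leNgt; apply/negP => xk'.
by have := kmin k; rewrite xk' (ltnW kp) ltnn => /(_ isT).
Qed.

Lemma PD_measurable_piece j : (j <= p)%N ->
  measurable_fun `]xi j, xi j.+1[ f.
Proof.
move=> jp; have [_ _ _ _ /(_ j jp)[g [gf gn _]]] := PDf.
apply: (@eq_measurable_fun _ _ _ _ _ (g 0%N)) => [x|].
  by rewrite inE; exact: gf.
apply: subspace_continuous_measurable_fun => //.
by apply: continuous_subspaceW (gn.1 _ (leq0n _)); exact: subset_itv_oo_cc.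
Qed.

Lemma PD_measurable : measurable_fun `[a, b] f.
Proof.
rewrite -xip; have : (p.+1 <= p.+1)%N by [].
elim: {1 3}p.+1 => [_|k IH kp].
  by rewrite xi0 set_itv1; exact: measurable_fun_set1.
have -> : `[a, xi k.+1]%classic = `[a, xi k] `|` `[xi k, xi k.+1].
  apply/seteqP; split=> x /=; rewrite !in_itv /=.
    move=> /andP[ax xk1]; have [xk|kx] := leP x (xi k); [left|right].
      by rewrite ax.
    by rewrite (ltW kx).
  have := @PD_le 0 k; rewrite xi0 (ltnW kp) => /(_ isT) ak.
  move=> [/andP[-> xk]|/andP[kx ->]]; last by rewrite andbT (le_trans ak).
  by rewrite (le_trans xk) // ltW // xi_lt.
apply/measurable_funU => //; split; first exact: IH (ltnW kp).
(* Adding the two end points keeps measurability, whatever the values of [f] there. *)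
exact: measurable_fun_itv_cc (PD_measurable_piece kp).
Qed.

Lemma PD_integrable q : mu.-integrable `[a, b] (EFin \o (fun x => q.[x] * f x)).
Proof.
by apply: integrable_horner_bounded; [exact: PD_measurable|case: PDf].
Qed.

Lemma PD_Rintegral h : mu.-integrable `[a, b] (EFin \o h) ->
  \int[mu]_(x in `[a, b]) h x =
  \sum_(j < p.+1) \int[mu]_(x in `[xi j, xi j.+1]) h x.
Proof.
suff split k : (k <= p.+1)%N -> mu.-integrable `[a, xi k] (EFin \o h) ->
    \int[mu]_(x in `[a, xi k]) h x =
    \sum_(j < k) \int[mu]_(x in `[xi j, xi j.+1]) h x.
  by rewrite -xip; exact: split.
elim: k => [_ _|k IH kp inth].
  by rewrite xi0 set_itv1 Rintegral_set1 big_ord0.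
have ak : a <= xi k by rewrite -xi0 PD_le // (ltnW kp).
have kk : xi k <= xi k.+1 by rewrite ltW // xi_lt.
rewrite (Rintegral_split ak kk inth) big_ord_recr /= IH // ?(ltnW kp) //.
by apply: integrableS inth => //; apply: subset_itvl; rewrite bnd_simp.
Qed.

Lemma PD_adjoint q : (forall j, (j <= p.+1)%N -> ('X - (xi j)%:P) ^+ n %| q) ->
  \int[mu]_(x in `[a, b]) ((adjoint P q).[x] * f x) = 0.
Proof.
move=> xiq; rewrite PD_Rintegral; last exact: PD_integrable.
apply: big1 => j _; have jp : (j <= p)%N by rewrite -ltnS.
have [_ _ _ _ /(_ j jp)[g [gf gn Pg]]] := PDf.
rewrite -[RHS](adjoint_jet (xi_lt jp) gn Pg (xiq j (leqW jp)) (xiq j.+1 jp)).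
(* [f] and its continuous extension [g 0] need only agree on the open piece: the end points do not
   affect the integral. *)
congr fine; apply: eq_integral_itv_bounded => [||x xj].
- apply: measurable_funM; last exact: PD_measurable_piece.
  apply: measurable_funS measurableT _ _ => //.
  by apply: continuous_measurable_fun; exact: continuous_horner.
- apply: subspace_continuous_measurable_fun => // x.
  apply: continuousM.
    by apply: continuous_subspaceT; exact: continuous_horner.
  by apply: continuous_subspaceW (gn.1 _ (leq0n _)) _; exact: subset_itv_oo_cc.
- by rewrite gf.
Qed.

Lemma PD_continuous j x : (j <= p)%N -> x \in `]xi j, xi j.+1[ ->
  {for x, continuous f}.
Proof.
move=> jp xj; have [_ _ _ _ /(_ j jp)[g [gf gn _]]] := PDf.
have /(continuous_within_itvP _ (xi_lt jp))[gc _ _] := gn.1 _ (leq0n n).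
rewrite /prop_for /continuous_at -(gf x xj).
apply: cvg_trans (gc x xj); apply: near_eq_cvg; near=> y.
by apply: gf; near: y; exact: near_in_itvoo.
Unshelve. all: by end_near. Qed.

End breakpoints.

(** * The bound on the order of vanishing moments, and on [sigma] *)

Lemma vanishing_order_lt (R : realType) (a b : R) (n : nat) (hn : (1 <= n)%N)
    (P : 'I_n.+1 -> {poly R}) (hP : P ord_max != 0) (p k : nat) :
  vanishing_orders a b P p k ->
  k%:Z < (maxn (n * p.+2).-1 (Lambda P))%:Z + alpha P.
Proof.
move=> [xi [f [PDf [x [xab xN]] fx0 fk]]]; rewrite ltNge; apply/negP => Mk.
have [j jp xj] := PD_locate PDf xab xN.
pose L q := \int[@lebesgue_measure R]_(x in `[a, b]) (q.[x] * f x).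
have Llin : linear_for *%R L.
  move=> c q r; rewrite /L -RintegralZl //; last exact: (PD_integrable PDf).
  rewrite -RintegralD //; last exact: (PD_integrable PDf).
    by apply: eq_Rintegral => y _; rewrite hornerD hornerZ mulrDl mulrA.
  under [X in _.-integrable _ X]funext do rewrite /= mulrA -hornerZ.
  exact: (PD_integrable PDf).
(* Integration against [f] is packaged as a linear form so that [functional_eq0] applies to it. *)
pose mL := GRing.isLinear.Build R {poly R} R *%R L Llin.
pose L' : {scalar {poly R}} := HB.pack L mL.
have xi_ab : x \in `]a, b[.
  have [_ [<- <-] _ _ _] := PDf; move: xj; rewrite !in_itv /= => /andP[xj1 xj2].
  have x0j : xi 0%N <= xi j by rewrite (PD_le PDf) // leqW.
  have xjp : xi j.+1 <= xi p.+1 by rewrite (PD_le PDf) // ltnS jp leqnn.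
  by rewrite (le_lt_trans x0j xj1) (lt_le_trans xj2 xjp).
apply/negP: fx0; rewrite negbK; apply/eqP.
apply: (moments_eq0 xi_ab (PD_continuous PDf jp xj)).
- exact: PD_measurable PDf.
- by case: PDf.
(* The product runs over all [p + 2] points, the end points [a] and [b] included, so that boundary
   terms vanish on every piece. *)
pose Om := \prod_(0 <= j < p.+2) ('X - (xi j)%:P) ^+ n.
have sOm : size Om = (n * p.+2).+1.
  have Om0 : Om != 0.
    apply: monic_neq0; apply: monic_prod => i _.
    by rewrite monic_exp ?monicXsubC.
  rewrite -[LHS]prednK ?size_poly_gt0 // /Om prodrXl size_exp; congr _.+1.
  by rewrite size_prod_XsubC size_iota subn0 mulnC.
apply: (functional_eq0 hP (L := L') (Om := Om) _ _ (leq_maxr _ _) Mk).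
- move=> q; apply: (PD_adjoint PDf) => i ip.
  rewrite /Om (bigD1_seq i) ?mem_index_iota ?iota_uniq //=.
  by rewrite dvdp_mull // dvdp_mulr.
- by rewrite sOm /= ltnS (leq_trans (leqSpred _)) // ltnS leq_maxl.
- move=> i ik; rewrite -[RHS](fk i ik); apply: eq_Rintegral => y _.
  by rewrite hornerXn.
Qed.

Theorem theorem3 (R : realType) (a b : R) (hab : a < b)
    (n : nat) (hn : (1 <= n)%N)
    (P : 'I_n.+1 -> {poly R}) (hP : P ord_max != 0) (p : nat) :
  (sigma a b P p <=
   ((Num.max (n%:Z * (p%:Z + 2) - 1) (Lambda P)%:Z + alpha P)%:~R : R)%:E)%E.
Proof.
have -> : Num.max (n%:Z * (p%:Z + 2) - 1) (Lambda P)%:Z =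
    (maxn (n * p.+2).-1 (Lambda P))%:Z.
  (* The truncated predecessor agrees with integer subtraction because [n >= 1]. *)
  have -> : n%:Z * (p%:Z + 2) - 1 = (n * p.+2).-1%:Z by nia.
  lia.
rewrite /sigma; case: asboolP => _; last first.
  (* When [sigma] is 0 by convention, the right-hand side must be shown nonnegative:
     [alpha P >= - n] and [n * (p + 2) - 1 >= n]. *)
  rewrite lee_fin ler0z; have := alpha_ge hP.
  have : (n <= (n * p.+2).-1)%N by nia.
  lia.
(* The strict inequality of [vanishing_order_lt] absorbs the [+ 1] in the definition of [sigma]. *)
rewrite -leeBrDr //; apply: ge_ereal_sup => _ [k kv <-].
rewrite -EFinB lee_fin lerBrDr -[k%:R]/(k%:~R) -[1]/(1%:~R) -intrD ler_int.
by have := vanishing_order_lt hn hP kv; lia.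
Qed.
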